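(* Let $p,q>3$ be distinct primes, and let $L_{m,n}$ be an irreducible $V(p,q)$-module, indexed by a pair $(m,n)$ of odd integers with $1\le m\le p-1$, $1\le n\le q-1$, such that $$(m,n)\notin\{(1,1),(1,q-2),(p-2,1),(p-2,q-2)\}.$$ Then the modular group representation $\rho_{m,n}$ arising from the action of $L_{m,n}$ is noncongruence, i.e. there is no positive integer $N$ such that $\Gamma(N)\subseteq\ker\rho_{m,n}$.
   Context: Minimal models. For coprime integers $p,q\ge 2$, $V(p,q)$ is the (simple, rational) Virasoro minimal model vertex operator algebra of central charge $\mathbf{c}=1-\frac{6(p-q)^2}{pq}$. Its irreducible modules are the $L_{m,n}$ ($0<m<p$, $0<n<q$), where $L_{m,n}$ has conformal weight $h_{m,n}=\frac{(np-mq)^2-(p-q)^2}{4pq}$; one has $L_{m,n}=L_{p-m,q-n}$, and there are no other coincidences. Standing convention: $p,m,n$ are odd. Admissible triples. For fixed $(m,n)$, a triple $\{(m,n),(m_j,n_j),(m_j,n_j)\}$ is admissible iff $0<m,m_j<p$, $0<n,n_j<q$, $m<2m_j$, $n<2n_j$, $m+2m_j<2p$, $n+2n_j<2q$, and $m+2m_j$, $n+2n_j$ are odd. It is identified with (equivalent to) $\{(m,n),(p-m_j,q-n_j),(p-m_j,q-n_j)\}$. Let $\{(m,n),(m_j,n_j),(m_j,n_j)\}$, $1\le j\le s$, be a complete list of inequivalent ones. For each $j$ the space of intertwining operators of type $\binom{L_{m_j,n_j}}{L_{m,n}\ L_{m_j,n_j}}$ is one-dimensional; fix a nonzero element $\mathcal{Y}_j$.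 1-point functions. For homogeneous $u\in L_{m,n}$ of $L(0)$-weight $\mathrm{wt}\,u$, write $\mathcal{Y}_j(u,z)=\sum_r u(r)z^{-r-1}$, $o(u)=u(\mathrm{wt}\,u-1)$ (extended linearly), and $S_j(u,\tau)=\mathrm{tr}|_{L_{m_j,n_j}}o(u)q^{L(0)-\mathbf{c}/24}$, with $q=e^{2\pi i\tau}$ in the $q$-expansion and $\tau\in\mathbb{H}$, the upper half-plane. The representation. Let $\Gamma=\mathrm{SL}_2(\mathbb{Z})$ and let $\Gamma(N)$ be the kernel of reduction $\Gamma\to\mathrm{SL}_2(\mathbb{Z}/N\mathbb{Z})$. For real $k$ let $\upsilon_k$ be the multiplier system of weight $k$ according to which $\eta^{2k}$ transforms ($\eta$ the Dedekind eta-function), so $\upsilon_k\begin{pmatrix}1&1\\0&1\end{pmatrix}=e^{2\pi i k/12}$. For $\gamma=\begin{pmatrix}a&b\\c&d\end{pmatrix}\in\Gamma$ put $(F|_k^{\upsilon}\gamma)(\tau)=\upsilon(\gamma)^{-1}(c\tau+d)^{-k}F\left(\frac{a\tau+b}{c\tau+d}\right)$. For $u$ a highest weight vector of $L_{m,n}$ (whose weight is $k=h_{m,n}$), the span of the linearly independent functions $S_1(u,\tau),\dots,S_s(u,\tau)$ is invariant under this action (with $\upsilon=\upsilon_k$), and $\rho_{m,n}:\Gamma\to\mathrm{GL}_s(\mathbb{C})$ is the representation with $F|_k^{\upsilon}\gamma=\rho_{m,n}(\gamma)F$ for $F=(S_1(u,\tau),\dots,S_s(u,\tau))^t$. *)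

(* Defs.v *)
From HB Require Import structures.
From mathcomp Require Import all_boot all_order all_algebra.
From mathcomp Require Import all_classical all_reals all_analysis.
From mathcomp Require Import complex.

Set Implicit Arguments.
Unset Strict Implicit.
Unset Printing Implicit Defensive.

Import Order.TTheory GRing.Theory Num.Theory.
Import numFieldNormedType.Exports.

Local Open Scope ring_scope.
Local Open Scope complex_scope.
Local Open Scope classical_set_scope.

(* Over a general numFieldType, because the topology of K is then found by
   inference, which fails for R[i] itself. *)
Definition csum (K : numFieldType) (f : nat -> K) : K := limn (series f).


Section LinearAlgebra.
Variables (C : numFieldType) (W : lmodType C).

Definition is_subspace (S : set W) : Prop :=
  S 0 /\ (forall (a : C) (x y : W), S x -> S y -> S (a *: x + y)).

Definition is_basis (P : set W) (d : nat) (b : 'I_d -> W) : Prop :=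
  (forall i, P (b i)) /\
  (forall w, P w -> exists! a : {ffun 'I_d -> C}, w = \sum_(i < d) a i *: b i).

Definition finite_dim (P : set W) : Prop :=
  exists (d : nat) (b : 'I_d -> W), is_basis P b.

(* The trace of f on the f-stable finite-dimensional subspace P. *)
Definition trace_on (P : set W) (f : W -> W) : C :=
  xget 0 [set t | exists (d : nat) (b : 'I_d -> W) (A : 'M[C]_d),
    [/\ is_basis P b,
        forall i, f (b i) = \sum_(j < d) A i j *: b j
      & t = \tr A]].

End LinearAlgebra.


Section Modes.
Variable C : numFieldType.

Definition binz (a : int) (i : nat) : C :=
  (\prod_(j < i) (a%:~R - j%:R)) / i`!%:R.

Definition bilinear_modes (Idx : Type) (U W X : lmodType C)
    (I : U -> Idx -> W -> X) : Prop :=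
  (forall r w, linear (fun u => I u r w)) /\ (forall u r, linear (I u r)).

Definition truncation (Idx : pzRingType) (U W X : lmodType C)
    (I : U -> Idx -> W -> X) : Prop :=
  forall u w (r : Idx), exists K, forall n, (K <= n)%N -> I u (r + n%:R) w = 0.

(* The coefficientwise form of the Jacobi identity
     z0^-1 d((z1-z2)/z0) Y(v,z1) I(u,z2) w
       - z0^-1 d((z2-z1)/(-z0)) I(u,z2) Y(v,z1) w
     = z2^-1 d((z1-z0)/z2) I(Y(v,z0)u,z2) w,
   with I(u,z) = sum_r u(r) z^(-r-1).  Each sum over i >= 0 has only finitely
   many nonzero terms by truncation, hence equality of all long enough partial
   sums.  Modes are indexed by integers for the action of an algebra on a module
   (Idx = int) and by complex numbers for intertwining operators (Idx = C). *)
Definition jacobi (Idx : pzRingType) (V U W X : lmodType C)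
    (YU : V -> int -> U -> U) (YW : V -> int -> W -> W)
    (YX : V -> int -> X -> X) (I : U -> Idx -> W -> X) : Prop :=
  forall (v : V) (u : U) (w : W) (l m : int) (r : Idx),
  exists K, forall N, (K <= N)%N ->
    \sum_(i < N) binz m i *: I (YU v (l + i%:Z) u) (m%:~R + r - i%:R) w
    = \sum_(i < N) ((-1) ^+ i * binz l i) *:
        (YX v (m + l - i%:Z) (I u (r + i%:R) w)
         - (-1 : C) ^ l *: I u (l%:~R + r - i%:R) (YW v (m + i%:Z) w)).

Definition eigenvectors (W : lmodType C) (f : W -> W) (lam : C) : set W :=
  [set w | f w = lam *: w].

End Modes.

(* In a vertex operator algebra, L(n) is the mode of index n+1 of the conformal
   vector. *)
Record voa (C : numFieldType) := VOA {
  voa_car :> lmodType C;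
  Y : voa_car -> int -> voa_car -> voa_car;
  vac : voa_car;
  conf : voa_car;
  charge : C;
  Y_bilinear : bilinear_modes Y;
  Y_truncation : truncation Y;
  Y_vac : forall n v, Y vac n v = if n == -1 then v else 0;
  Y_creation : forall v, Y v (-1) vac = v /\ forall n : nat, Y v n%:Z vac = 0;
  Y_jacobi : jacobi Y Y Y Y;
  Y_virasoro : forall (m n : int) (v : voa_car),
    Y conf (m + 1) (Y conf (n + 1) v) - Y conf (n + 1) (Y conf (m + 1) v)
    = (m - n)%:~R *: Y conf (m + n + 1) v
      + (if m + n == 0 then ((m ^+ 3 - m)%:~R / 12%:R) * charge else 0) *: v;
  Y_derivative : forall (v : voa_car) (n : int) (w : voa_car),
    Y (Y conf 0 v) n w = - (n%:~R *: Y v (n - 1) w);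
  Y_graded : forall v, exists (d : nat) (n : 'I_d -> int) (x : 'I_d -> voa_car),
    (forall i, eigenvectors (Y conf 1) (n i)%:~R (x i)) /\ v = \sum_(i < d) x i;
  Y_finite : forall n : int, finite_dim (eigenvectors (Y conf 1) n%:~R);
  Y_bounded : exists K : int, forall n : int, n < K ->
    forall v, eigenvectors (Y conf 1) n%:~R v -> v = 0
}.

Record voa_module (C : numFieldType) (V : voa C) := VOAModule {
  mod_car :> lmodType C;
  act : V -> int -> mod_car -> mod_car;
  act_bilinear : bilinear_modes act;
  act_truncation : truncation act;
  act_vac : forall n w, act (vac V) n w = if n == -1 then w else 0;
  act_jacobi : jacobi (@Y C V) act act act;
  act_virasoro : forall (m n : int) (w : mod_car),
    act (conf V) (m + 1) (act (conf V) (n + 1) w)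
      - act (conf V) (n + 1) (act (conf V) (m + 1) w)
    = (m - n)%:~R *: act (conf V) (m + n + 1) w
      + (if m + n == 0 then ((m ^+ 3 - m)%:~R / 12%:R) * charge V else 0) *: w;
  act_derivative : forall (v : V) (n : int) (w : mod_car),
    act (Y (conf V) 0 v) n w = - (n%:~R *: act v (n - 1) w);
  act_graded : forall w, exists (d : nat) (lam : 'I_d -> C) (x : 'I_d -> mod_car),
    (forall i, eigenvectors (act (conf V) 1) (lam i) (x i))
    /\ w = \sum_(i < d) x i;
  act_finite : forall lam : C, finite_dim (eigenvectors (act (conf V) 1) lam);
  act_bounded : forall lam : C, exists K, forall n, (K <= n)%N ->
    forall w, eigenvectors (act (conf V) 1) (lam - n%:R) w -> w = 0
}.

Section Modules.
Variables (C : numFieldType) (V : voa C).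

Definition virL (M : voa_module V) (n : int) (w : M) : M := act (conf V) (n + 1) w.

Definition weight_space (M : voa_module V) (lam : C) : set M :=
  eigenvectors (@virL M 0) lam.

Definition irreducible_module (M : voa_module V) : Prop :=
  (exists w : M, w <> 0) /\
  forall S : set M, is_subspace S ->
    (forall v n w, S w -> S (act v n w)) ->
    (forall w, S w -> w = 0) \/ (forall w, S w).

Definition highest_weight_vector (M : voa_module V) (h : C) (w : M) : Prop :=
  [/\ w <> 0, weight_space h w & forall n : int, 0 < n -> virL n w = 0].

(* Intertwining operators of type (M3 / M1 M2). *)
Definition intertwining_operator (M1 M2 M3 : voa_module V)
    (I : M1 -> C -> M2 -> M3) : Prop :=
  [/\ bilinear_modes I,
      truncation I,
      jacobi (@act C V M1) (@act C V M2) (@act C V M3) I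
    & forall (u : M1) (r : C) (w : M2),
        I (virL (-1) u) r w = - (r *: I u (r - 1) w)].

Definition nonzero_modes (M1 M2 M3 : voa_module V)
    (I : M1 -> C -> M2 -> M3) : Prop :=
  exists u r w, I u r w <> 0.

End Modules.


Section MinimalModels.
Variable R : realType.

Definition central_charge (p q : nat) : R :=
  1 - 6%:R * (p%:R - q%:R) ^+ 2 / (p%:R * q%:R).

Definition conformal_weight (p q m n : nat) : R :=
  ((n%:R * p%:R - m%:R * q%:R) ^+ 2 - (p%:R - q%:R) ^+ 2)
  / (4%:R * p%:R * q%:R).

(* V(p,q) is the vertex operator algebra whose underlying Virasoro module is the
   irreducible highest weight module of central charge c and weight 0; the
   highest weight vector is the vacuum, so only irreducibility over the Virasoro
   algebra has to be required. *)
Definition is_minimal_model (p q : nat) (V : voa R[i]) : Prop :=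
  [/\ charge V = (central_charge p q)%:C,
      vac V <> 0
    & forall S : set V, is_subspace S ->
        (forall n v, S v -> S (Y (conf V) n v)) ->
        (forall v, S v -> v = 0) \/ (forall v, S v)].

(* M is isomorphic to L_{m,n}: in an irreducible module, the weight of a highest
   weight vector is the conformal weight. *)
Definition is_L (p q m n : nat) (V : voa R[i]) (M : voa_module V) : Prop :=
  irreducible_module M /\
  exists w : M, highest_weight_vector (conformal_weight p q m n)%:C w.

End MinimalModels.

(* Triples {(m,n),(a,b),(a,b)}, for fixed (m,n), given by the pair ab = (a,b). *)

Definition admissible (p q m n : nat) (ab : nat * nat) : Prop :=
  [/\ (0 < m < p)%N && (0 < ab.1 < p)%N,
      (0 < n < q)%N && (0 < ab.2 < q)%N,
      (m < 2 * ab.1)%N && (n < 2 * ab.2)%N,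
      (m + 2 * ab.1 < 2 * p)%N && (n + 2 * ab.2 < 2 * q)%N
    & odd (m + 2 * ab.1) && odd (n + 2 * ab.2)].

Definition equivalent_pairs (p q : nat) (ab cd : nat * nat) : Prop :=
  cd = ab \/ cd = ((p - ab.1)%N, (q - ab.2)%N).

Definition complete_admissible_list (p q m n s : nat)
    (mn : 'I_s -> nat * nat) : Prop :=
  [/\ forall j, admissible p q m n (mn j),
      forall i j, equivalent_pairs p q (mn i) (mn j) -> i = j
    & forall ab, admissible p q m n ab ->
        exists j, equivalent_pairs p q (mn j) ab].


Section ComplexFunctions.
Variable R : realType.
Local Notation C := R[i].

Definition cexp (z : C) : C :=
  (expR (complex.Re z))%:C * (cos (complex.Im z) +i* sin (complex.Im z)).

Definition cabs (z : C) : R :=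
  Num.sqrt (complex.Re z ^+ 2 + complex.Im z ^+ 2).

(* The principal argument, in ]-pi, pi]. *)
Definition carg (z : C) : R :=
  if 0 <= complex.Im z then acos (complex.Re z / cabs z)
  else - acos (complex.Re z / cabs z).

Definition clog (z : C) : C := ln (cabs z) +i* carg z.

Definition cpow (z : C) (k : R) : C := cexp (k%:C * clog z).

Definition upper_half_plane : set C := [set tau | 0 < complex.Im tau].

Definition two_pi_i : C := 0 +i* (2%:R * pi).

(* log eta(tau) = 2 pi i tau / 24 + sum_(n >= 1) log (1 - q^n), where all the
   logarithms on the right-hand side are principal. *)
Definition log_eta (tau : C) : C :=
  two_pi_i * tau / 24%:R
  + csum (fun n => clog (1 - cexp (two_pi_i * (n.+1)%:R * tau))).

Definition eta_pow (a : R) (tau : C) : C := cexp (a%:C * log_eta tau).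

End ComplexFunctions.


Section ModularGroup.
Variable R : realType.
Local Notation C := R[i].

Definition SL2Z : set 'M[int]_2 := [set A | \det A = 1].

Definition Gamma (N : nat) : set 'M[int]_2 :=
  [set A | SL2Z A /\
    forall i j, (A i j = (1%:M : 'M[int]_2) i j %[mod N%:Z])%Z].

Definition automorphy (A : 'M[int]_2) (tau : C) : C :=
  (A 1 0)%:~R * tau + (A 1 1)%:~R.

Definition moebius (A : 'M[int]_2) (tau : C) : C :=
  ((A 0 0)%:~R * tau + (A 0 1)%:~R) / automorphy A tau.

(* ups is the multiplier system of weight k of eta^(2k). *)
Definition eta_multiplier (k : R) (ups : 'M[int]_2 -> C) : Prop :=
  forall (A : 'M[int]_2) (tau : C), SL2Z A -> upper_half_plane tau ->
    eta_pow (2%:R * k) (moebius A tau)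
    = ups A * cpow (automorphy A tau) k * eta_pow (2%:R * k) tau.

Definition slash (k : R) (ups : 'M[int]_2 -> C) (A : 'M[int]_2)
    (F : C -> C) (tau : C) : C :=
  (ups A)^-1 * cpow (automorphy A tau) (- k) * F (moebius A tau).

(* Representations SL_2(Z) -> GL_s(C); only the values of rho on SL2Z matter,
   and they are automatically invertible. *)
Definition is_representation (s : nat) (rho : 'M[int]_2 -> 'M[C]_s) : Prop :=
  rho 1%:M = 1%:M /\
  (forall A B, SL2Z A -> SL2Z B -> rho (A *m B) = rho A *m rho B).

Definition rep_kernel (s : nat) (rho : 'M[int]_2 -> 'M[C]_s) : set 'M[int]_2 :=
  [set A | SL2Z A /\ rho A = 1%:M].

Definition noncongruence (s : nat) (rho : 'M[int]_2 -> 'M[C]_s) : Prop :=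
  ~ exists N : nat, (0 < N)%N /\ Gamma N `<=` rep_kernel rho.

Definition lin_indep_on_H (s : nat) (F : 'I_s -> C -> C) : Prop :=
  forall a : 'I_s -> C,
    (forall tau, upper_half_plane tau -> \sum_(j < s) a j * F j tau = 0) ->
    forall j, a j = 0.

(* F |_k A = rho(A) F for every A, with F the column (F_1, ..., F_s)^t. *)
Definition transforms_by (s : nat) (k : R) (ups : 'M[int]_2 -> C)
    (F : 'I_s -> C -> C) (rho : 'M[int]_2 -> 'M[C]_s) : Prop :=
  forall (A : 'M[int]_2) (tau : C), SL2Z A -> upper_half_plane tau ->
    forall i, slash k ups A (F i) tau = \sum_(j < s) rho A i j * F j tau.

End ModularGroup.


Section OnePoint.
Variable R : realType.
Local Notation C := R[i].

(* o(u), for u homogeneous of weight k. *)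
Definition zero_mode (V : voa C) (M W : voa_module V) (I : M -> C -> W -> W)
    (k : C) (u : M) : W -> W := I u (k - 1).

(* tr_W o(u) q^(L(0) - c/24), for u homogeneous of weight k and W irreducible of
   conformal weight h, so that the eigenvalues of L(0) on W lie in h + nat. *)
Definition one_point (V : voa C) (M W : voa_module V) (I : M -> C -> W -> W)
    (h k : C) (u : M) (tau : C) : C :=
  csum (fun n : nat =>
    trace_on (@weight_space _ _ W (h + n%:R)) (zero_mode I k u)
    * cexp (two_pi_i R * tau * (h + n%:R - charge V / 24%:R))).

End OnePoint.

(* Main.v *)
Require Import Defs.
From mathcomp Require Import all_boot all_order all_algebra ring zify lra.
From mathcomp Require Import all_classical all_reals all_analysis.
From mathcomp Require Import complex.
Import Order.TTheory GRing.Theory Num.Theory.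
Import numFieldNormedType.Exports.
Local Open Scope ring_scope.
Local Open Scope complex_scope.

(** The spectrum of rho(T), for T the translation tau |-> tau + 1, already decides
    the question.

    Each S_j is a power series in q times q^(h_j - c/24), and the multiplier
    system contributes e^(2 pi i k/12) at T, with k = h_{m,n}; so, the S_j being
    linearly independent, rho(T) is diagonal with entries e^(2 pi i r_j), where
    r_j = h_j - c/24 - k/12 ([rho_translation]).

    Assume that rho is trivial on Gamma(N).  For x prime to N, T and T^(x^2) are
    conjugate modulo N, by a lift of diag(x, 1/x); hence the set of eigenvalues of
    rho(T) is stable under z |-> z^(x^2) ([congruence_spectrum]), that is, the set
    of the r_j modulo 1 is stable under multiplication by x^2.

    Write r_j = E_j/(48pq) with E_j an integer.  Modulo p, E_j is
    q^2 (12 a^2 - m^2 + 1), where a = m_j runs over the integers with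
    m/2 < a < p - m/2.  Since x can be prescribed modulo p while staying prime to
    N, the set A of the values 12 a^2 - m^2 + 1 in F_p is stable under
    multiplication by the nonzero squares.  As a and p - a give the same value,
    A has (p - m)/2 elements.  If m <> p - 2 then A has at least two elements, so
    it has a nonzero one, whose orbit under the squares has (p - 1)/2 elements;
    this forces m = 1 ([square_stable_values]).  Exchanging the roles of p and q
    gives n = 1 or n = q - 2, and these are exactly the excluded pairs. *)

Set Implicit Arguments.
Unset Strict Implicit.
Unset Printing Implicit Defensive.

(** * Subsets of F_p stable under multiplication by squares *)

Lemma injective_squares_Fp (p x y : nat) :
  prime p -> (2 * x < p)%N -> (2 * y < p)%N ->
  x%:R ^+ 2 = y%:R ^+ 2 :> 'F_p -> x = y.
Proof.
move=> p_pr xp yp.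
wlog le_xy : x y xp yp / (x <= y)%N.
  move=> H; case/orP: (leq_total x y) => [|le_yx e]; first exact: H.
  by apply/esym/H.
move/esym/eqP; rewrite -subr_eq0 subr_sqr -natrB // -natrD -natrM.
rewrite -(dvdn_pcharf (pchar_Fp p_pr)) Euclid_dvdM // => /orP[] /dvdn_leq; lia.
Qed.

(** Folding a |-> p - a, the values come from the (p - m)/2 integers a between m/2
    and p/2, on which they are pairwise distinct because 12 is invertible.  As soon
    as there are two of them one is nonzero, and its (p - 1)/2 multiples by squares
    have to fit in a set of size (p - m)/2. *)
Lemma square_stable_values (p m : nat) :
  prime p -> (3 < p)%N -> odd m -> (m < p)%N ->
  (forall a x, (m < 2 * a)%N -> (m + 2 * a < 2 * p)%N -> ~~ (p %| x)%N ->
     exists b, [/\ (m < 2 * b)%N, (m + 2 * b < 2 * p)%N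
       & x%:R ^+ 2 * (12 * a%:R ^+ 2 - m%:R ^+ 2 + 1)
         = 12 * b%:R ^+ 2 - m%:R ^+ 2 + 1 :> 'F_p]) ->
  m = 1%N \/ m = (p - 2)%N.
Proof.
move=> p_pr p3 m_odd m_lt_p stable.
have p_odd : odd p by case/even_prime: p_pr p3 => ->.
have char_p := pchar_Fp p_pr.
have F12 : 12 != 0 :> 'F_p.
  rewrite -(dvdn_pcharf char_p) (Euclid_dvdM 4 3 p_pr) negb_or.
  by rewrite (Euclid_dvdM 2 2 p_pr) orbb !gtnNdvd //; lia.
pose f (a : nat) : 'F_p := 12 * a%:R ^+ 2 - m%:R ^+ 2 + 1.
have f_inj a b : (2 * a < p)%N -> (2 * b < p)%N -> f a = f b -> a = b.
  by move=> ap bp /addIr/addIr/(mulfI F12); apply: injective_squares_Fp.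
have f_refl a : (a <= p)%N -> f (p - a)%N = f a.
  by move=> ap; rewrite /f natrB // pchar_Fp_0 // sub0r sqrrN.
case: (eqVneq m (p - 2)%N) => [|m_neq]; first by right.
left.
(* Otherwise the two largest integers below p/2 lie in the range, and f cannot
   vanish at both. *)
have [a [am ap fa]] : exists a, [/\ (m < 2 * a)%N, (m + 2 * a < 2 * p)%N & f a != 0].
  case: (eqVneq (f p./2) 0) => [f1|f1]; last by exists p./2; split=> //; lia.
  exists p./2.-1; split; try lia.
  apply/eqP => f2; have : p./2 = p./2.-1 by apply: f_inj; rewrite ?f1 ?f2 //; lia.
  lia.
(* The orbit of the nonzero value f a, and all the values: b goes from (m + 1)/2 to
   (p - 1)/2. *)
pose s1 := [seq x%:R ^+ 2 * f a | x <- iota 1 p./2].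
pose s2 := [seq f b | b <- iota m./2.+1 (p./2 - m./2)].
have : (size s1 <= size s2)%N.
  apply: uniq_leq_size.
    rewrite map_inj_in_uniq ?iota_uniq // => x y; rewrite !mem_iota => hx hy.
    move/(mulIf fa); apply: injective_squares_Fp => //; lia.
  move=> _ /mapP[x + ->]; rewrite mem_iota => hx.
  have px : ~~ (p %| x)%N by rewrite gtnNdvd //; lia.
  have [b [bm bp e]] := stable a x am ap px.
  apply/mapP; case: (leqP (2 * b) p) => hb; [exists b | exists (p - b)%N] => //.
  - by rewrite mem_iota; lia.
  - by rewrite mem_iota; lia.
  - by rewrite f_refl //; lia.
rewrite !size_map !size_iota; lia.
Qed.

(** * Eigenvalues of T in a congruence representation *)

(** A row of an invertible P has a nonzero entry, and the (i, j) entry of the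
    relation reads P i j * d j = e i * P i j. *)
Lemma diag_conj_spectrum (K : fieldType) (s : nat) (P Q : 'M[K]_s)
    (d e : 'rV[K]_s) :
  P *m Q = 1%:M -> P *m diag_mx d = diag_mx e *m P ->
  forall i, exists j, d 0 j = e 0 i.
Proof.
move=> PQ com i.
have [j Pij] : exists j, P i j != 0.
  apply/existsP; apply: contraT; rewrite negb_exists => /forallP P0.
  have := congr1 (fun A : 'M[K]_s => A i i) PQ; rewrite !mxE eqxx big1.
    by move/esym/eqP; rewrite oner_eq0.
  by move=> j _; move: (P0 j); rewrite negbK => /eqP ->; rewrite mul0r.
exists j; apply: (mulfI Pij).
have := congr1 (fun A : 'M[K]_s => A i j) com.
by rewrite mul_mx_diag mul_diag_mx !mxE [RHS]mulrC.
Qed.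

Definition mx22 (a b c d : int) : 'M[int]_2 :=
  \matrix_(i, j) if i == 0 then (if j == 0 then a else b)
                 else (if j == 0 then c else d).

Lemma mx22P (A B : 'M[int]_2) :
  A 0 0 = B 0 0 -> A 0 1 = B 0 1 -> A 1 0 = B 1 0 -> A 1 1 = B 1 1 -> A = B.
Proof.
move=> h1 h2 h3 h4; apply/matrixP.
have I2 (k : 'I_2) : k = 0 \/ k = 1.
  by case: k => [[|[|//]] k_lt]; [left | right]; apply: val_inj.
by move=> i j; case: (I2 i) (I2 j) => -> [] ->.
Qed.

Lemma mulmx22 a b c d a' b' c' d' :
  mx22 a b c d *m mx22 a' b' c' d' =
  mx22 (a * a' + b * c') (a * b' + b * d') (c * a' + d * c') (c * b' + d * d').
Proof. by apply: mx22P; rewrite !mxE !big_ord_recl big_ord0 !mxE /= addr0. Qed.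

Lemma SL2Z_mx22 a b c d : SL2Z (mx22 a b c d) <-> a * d - b * c = 1.
Proof.
by rewrite /SL2Z /= (expand_det_row _ 0) !big_ord_recl big_ord0 /cofactor
  !det_mx11 !mxE /= expr0 expr1 mul1r addr0 mulN1r mulrN.
Qed.

Definition translation (k : int) : 'M[int]_2 := mx22 1 k 0 1.

Lemma SL2Z_translation k : SL2Z (translation k).
Proof. by apply/SL2Z_mx22; rewrite mulr0 subr0 mulr1. Qed.

Lemma SL2Z_mulmx A B : SL2Z A -> SL2Z B -> SL2Z (A *m B).
Proof. by rewrite /SL2Z /= det_mulmx => -> ->. Qed.

Lemma SL2Z_invmx A : SL2Z A -> SL2Z (invmx A).
Proof. by rewrite /SL2Z /= det_inv => ->; rewrite invr1. Qed.

Lemma SL2Z_unitmx A : SL2Z A -> A \in unitmx.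
Proof. by rewrite /SL2Z /= unitmxE => ->; rewrite unitr1. Qed.

Section CongruenceRepresentation.
Variables (R : realType) (s : nat) (rho : 'M[int]_2 -> 'M[R[i]]_s).
Hypothesis rhoP : is_representation rho.

Lemma rep_translation (d : 'rV[R[i]]_s) (k : nat) :
  rho (translation 1) = diag_mx d ->
  rho (translation k%:Z) = diag_mx (\row_j d 0 j ^+ k).
Proof.
case: rhoP => rho1 rhoM rhoT; elim: k => [|k IHk].
  rewrite (_ : translation _ = 1%:M); last by apply: mx22P; rewrite !mxE.
  by rewrite rho1 -diag_const_mx; congr diag_mx; apply/rowP=> j; rewrite !mxE expr0.
rewrite (_ : translation _ = translation 1 *m translation k%:Z); last first.
  by rewrite mulmx22 /translation; congr mx22; lia.
rewrite rhoM ?rhoT ?IHk //; try exact: SL2Z_translation.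
by rewrite mulmx_diag; congr diag_mx; apply/rowP=> j; rewrite !mxE exprS.
Qed.

(** The hypothesis on Gamma(N) is about a kernel; this is the equivalent form in
    which rho factors through reduction modulo N. *)
Lemma rep_eq_mod (N : nat) (A B : 'M[int]_2) :
  (Gamma N `<=` rep_kernel rho)%classic -> SL2Z A -> SL2Z B ->
  (forall i j, (A i j = B i j %[mod N%:Z])%Z) -> rho A = rho B.
Proof.
case: rhoP => rho1 rhoM kerN SA SB AB.
have iB := SL2Z_unitmx SB.
have : Gamma N (A *m invmx B).
  split; first by apply: SL2Z_mulmx => //; apply: SL2Z_invmx.
  move=> i j; rewrite -(mulmxV iB); apply/eqP; rewrite eqz_mod_dvd !mxE -sumrB.
  apply: rpred_sum => k _; rewrite -mulrBl; apply: dvdz_mulr.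
  by rewrite -eqz_mod_dvd; apply/eqP.
case/kerN => SAB rhoAB.
by rewrite -[A](mulmxKV iB) rhoM // rhoAB mul1mx.
Qed.

(** In SL_2(Z/N), conjugation by diag(x, 1/x) sends T to T^(x^2).  An integral lift of
    diag(x, 1/x) is obtained by completing the first row (x, N) with a second row
    (-vN, y), where xy + vN^2 = 1. *)
Lemma congruence_spectrum (N x : nat) (d : 'rV[R[i]]_s) :
  (Gamma N `<=` rep_kernel rho)%classic -> coprime x N ->
  rho (translation 1) = diag_mx d ->
  forall i, exists j, d 0 j = d 0 i ^+ (x ^ 2).
Proof.
move=> kerN coxN rhoT i; have [rho1 rhoM] := rhoP.
have [y [v xyv]] : exists y v : int, y * x%:Z + v * (N%:Z * N%:Z) = 1.
  have [y [v]] := Bezoutz x%:Z (N%:Z * N%:Z).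
  rewrite (eqP (_ : coprimez x%:Z (N%:Z * N%:Z))); first by exists y, v.
  by rewrite coprimezMr !coprimezE /= coxN.
pose D := mx22 x%:Z N%:Z (- v * N%:Z) y.
have SD : SL2Z D by apply/SL2Z_mx22; lia.
have ST := SL2Z_translation.
have DT : D *m translation 1 = mx22 x%:Z (x%:Z + N%:Z) (- v * N%:Z) (y - v * N%:Z).
  by rewrite mulmx22; congr mx22; lia.
have xxy : x%:Z * x%:Z * y = x%:Z * (1 - v * (N%:Z * N%:Z)).
  by rewrite -xyv; ring.
have TD : translation (x ^ 2)%N%:Z *m D =
    mx22 (x%:Z - x%:Z * x%:Z * v * N%:Z) (N%:Z + x%:Z * (1 - v * (N%:Z * N%:Z)))
      (- v * N%:Z) y.
  by rewrite mulmx22 -xxy; congr mx22; lia.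
have com : rho D *m diag_mx d = diag_mx (\row_j d 0 j ^+ (x ^ 2)) *m rho D.
  rewrite -(rep_translation (x ^ 2) rhoT) -rhoT -!rhoM //.
  apply: (rep_eq_mod kerN) => //; try exact: SL2Z_mulmx.
  rewrite DT TD => k l; apply/eqP; rewrite eqz_mod_dvd; apply/dvdzP.
  rewrite !mxE; case: ifP => _; case: ifP => _.
  - by exists (x%:Z * x%:Z * v); lia.
  - by exists (x%:Z * v * N%:Z); lia.
  - by exists 0; lia.
  - by exists (- v); lia.
have [|j] := diag_conj_spectrum (Q := rho (invmx D)) _ com i.
  by rewrite -rhoM ?mulmxV ?rho1 //; [exact: SL2Z_unitmx|exact: SL2Z_invmx].
by rewrite mxE; exists j.
Qed.

End CongruenceRepresentation.

(** * The values e^(2 pi i r) and the translation *)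

(** A divergent series and its nonzero multiples all get the default limit 0, so the
    identity holds in that case too. *)
Lemma csumMl (K : numFieldType) (c : K) (f : nat -> K) :
  c != 0 -> csum (fun n => c * f n) = c * csum f.
Proof.
move=> c0; have [cvf|dvf] := pselect (cvgn (series f)).
  exact: lim_seriesZ.
rewrite /csum (dvgP dvf) dvgP; first by rewrite mulr0.
move=> cvcf; apply: dvf.
rewrite (_ : f = c^-1 *: (fun n => c * f n)); first exact: is_cvg_seriesZ.
by apply/funext => n; rewrite /= fctE /GRing.scale /= mulKf.
Qed.

Section CircleExponential.
Variable R : realType.
Local Notation C := R[i].

Lemma cexpD (z w : C) : cexp (z + w) = cexp z * cexp w.
Proof.
case: z w => [a b] [a' b']; rewrite /cexp /= expRD cosD sinD.
by apply/eqP; rewrite eq_complex /=; apply/andP; split; apply/eqP; ring.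
Qed.

Lemma cexp0 : cexp (0 : C) = 1.
Proof. by rewrite /cexp /= expR0 cos0 sin0 mul1r. Qed.

Lemma cexp_neq0 (z : C) : cexp z != 0.
Proof.
apply/eqP => z0; have := cexpD z (- z).
by rewrite subrr cexp0 z0 mul0r => /eqP; rewrite oner_eq0.
Qed.

Definition e2pi (r : R) : C := cexp (two_pi_i R * r%:C).

Lemma e2piE r : e2pi r = cos (2 * pi * r) +i* sin (2 * pi * r).
Proof.
rewrite /e2pi /cexp /two_pi_i /=.
by rewrite !(mul0r, mulr0, subr0, addr0, add0r, oppr0) expR0 mul1r.
Qed.

Lemma e2piD r t : e2pi (r + t) = e2pi r * e2pi t.
Proof. by rewrite /e2pi rmorphD mulrDr cexpD. Qed.

Lemma e2pi0 : e2pi 0 = 1. Proof. by rewrite /e2pi mulr0 cexp0. Qed.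

Lemma e2piN r : e2pi (- r) = (e2pi r)^-1.
Proof.
by apply: (mulfI (cexp_neq0 _ : e2pi r != 0)); rewrite -e2piD subrr e2pi0 divff ?cexp_neq0.
Qed.

Lemma e2piMn r k : e2pi (k%:R * r) = e2pi r ^+ k.
Proof.
elim: k => [|k IHk]; first by rewrite mul0r e2pi0.
by rewrite -natr1 mulrDl mul1r e2piD IHk exprSr.
Qed.

Lemma e2pi1 : e2pi 1 = 1.
Proof. by rewrite e2piE mulr1 mulrC mulr_natr cos2pi sin2pi. Qed.

Lemma e2pi_nat k : e2pi k%:R = 1.
Proof. by rewrite -[k%:R]mulr1 e2piMn e2pi1 expr1n. Qed.

Lemma e2pi_int (z : int) : e2pi z%:~R = 1.
Proof.
by case: z => k; rewrite ?NegzE ?rmorphN ?e2piN e2pi_nat ?invr1.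
Qed.

(** The real part of the equation gives 1 - 2 sin(pi r)^2 = 1, and sin is positive on
    ]0, pi[. *)
Lemma e2pi_eq1_itv r : 0 <= r < 1 -> e2pi r = 1 -> r = 0.
Proof.
case/andP=> r0 r1; rewrite e2piE => -[cosr _].
have : sin (pi * r) = 0.
  apply/eqP; rewrite -sqrf_eq0; apply/eqP.
  move: cosr; rewrite (_ : 2 * pi * r = (pi * r) *+ 2); last by ring.
  rewrite cos_mulr2n sin2cos2; lra.
have pi0 := pi_gt0 R.
move=> sr; apply/eqP; apply: contraT => rn0.
have rp : 0 < r by rewrite lt0r rn0.
have : 0 < sin (pi * r).
  by apply: sin_gt0_pi; rewrite mulr_gt0 //= -ltr_pdivlMl // mulVf ?lt0r_neq0.
by rewrite sr ltxx.
Qed.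

Lemma e2pi_ratio_dvd (M : nat) (z : int) :
  (0 < M)%N -> e2pi (z%:~R / M%:R) = 1 -> (M %| z)%Z.
Proof.
move=> M0 e1.
have M0R : M%:R != 0 :> R by rewrite pnatr_eq0 -lt0n.
have M0z : M%:Z != 0 by lia.
apply/dvdz_mod0P.
have := @e2pi_eq1_itv ((z %% M%:Z)%Z%:~R / M%:R).
have : e2pi ((z %% M%:Z)%Z%:~R / M%:R) = 1.
  move: e1; rewrite {1}(divz_eq z M%:Z) intrD intrM mulrDl e2piD.
  by rewrite mulfK // e2pi_int mul1r.
move=> -> /(_ _ erefl) H; apply/eqP.
rewrite -(intr_eq0 R) -(mulIr_eq0 _ (mulIf (invr_neq0 M0R))); apply/eqP/H.
rewrite divr_ge0 ?ler0n ?ler0z ?modz_ge0 //=.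
by rewrite ltr_pdivrMr ?ltr0n // mul1r -[M%:R]/(M%:Z%:~R) ltr_int; exact: ltz_pmod.
Qed.

Lemma e2pi_ratio_eq_dvd (M : nat) (z w : int) :
  (0 < M)%N -> e2pi (z%:~R / M%:R) = e2pi (w%:~R / M%:R) -> (M %| z - w)%Z.
Proof.
move=> M0 e; apply: e2pi_ratio_dvd => //.
by rewrite rmorphB mulrBl e2piD e2piN e divff ?cexp_neq0.
Qed.

Lemma cpow1 (k : R) : cpow 1 k = 1.
Proof.
rewrite /cpow /clog /carg /cabs /= lexx expr1n expr0n /= addr0 sqrtr1.
by rewrite divr1 ln1 acos1 mulr0 cexp0.
Qed.

(** The infinite product in eta is a function of q = e^(2 pi i tau), so only the
    leading factor q^(1/24) changes. *)
Lemma log_etaD1 (tau : C) : log_eta (tau + 1) = log_eta tau + two_pi_i R / 24.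
Proof.
rewrite /log_eta mulrDr mulr1 mulrDl -!addrA; congr (_ + _).
rewrite addrC; congr (_ + _); congr csum; apply/funext => n.
rewrite mulrDr mulr1 cexpD (_ : two_pi_i R * (n.+1)%:R = two_pi_i R * (n.+1%:R)%:C).
  by rewrite -/(e2pi _) e2pi_nat mulr1.
by rewrite rmorph_nat.
Qed.

(** Here the automorphy factor is 1, so the defining relation of the multiplier,
    evaluated at the point i, compares eta^(2k) at i + 1 and at i. *)
Lemma eta_multiplier_translation (k : R) (ups : 'M[int]_2 -> C) (T : 'M[int]_2) :
  eta_multiplier k ups -> SL2Z T -> T 0 0 = 1 -> T 0 1 = 1 -> T 1 0 = 0 -> T 1 1 = 1 ->
  ups T = e2pi (k / 12).
Proof.
move=> upsP ST T00 T01 T10 T11.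
have := upsP T (0 +i* 1) ST ltr01.
have -> : automorphy T (0 +i* 1 : C) = 1 by rewrite /automorphy T10 T11 mul0r add0r.
have -> : moebius T (0 +i* 1 : C) = (0 +i* 1) + 1.
  by rewrite /moebius /automorphy T00 T01 T10 T11 mul0r add0r divr1 mul1r.
rewrite cpow1 mulr1 /eta_pow log_etaD1 mulrDr cexpD mulrC => /(mulIf (cexp_neq0 _)) <-.
rewrite /e2pi; congr cexp.
by rewrite !rmorphM fmorphV /= !rmorph_nat; field.
Qed.

Lemma one_point_translation (V : voa C) (M W : voa_module V) (I : M -> C -> W -> W)
    (h c : R) (k : C) (u : M) (tau : C) :
  Defs.charge V = c%:C ->
  one_point I h%:C k u (tau + 1) = e2pi (h - c / 24) * one_point I h%:C k u tau.
Proof.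
move=> cV; rewrite /one_point -csumMl ?cexp_neq0 //; congr csum; apply/funext => n.
rewrite [RHS]mulrCA; congr (_ * _).
rewrite (mulrDr (two_pi_i R) tau) mulr1 mulrDl cexpD [LHS]mulrC; congr (_ * _).
rewrite (_ : h%:C + _ - _ = (h - c / 24 + n%:R)%:C).
  by rewrite -/(e2pi _) e2piD e2pi_nat mulr1.
rewrite cV !(rmorphD, rmorphB, rmorphM, fmorphV, rmorphN) /= !rmorph_nat; ring.
Qed.

End CircleExponential.

(** * The exponents of the minimal models *)

(** The integer E with h_{a,b} - c/24 - h_{m,n}/12 = E / (48 p q), for (a,b) = ab. *)
Definition exponent_num (p q m n : nat) (ab : nat * nat) : int :=
  12 * (ab.2%:Z * p%:Z - ab.1%:Z * q%:Z) ^+ 2 - (n%:Z * p%:Z - m%:Z * q%:Z) ^+ 2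
  + (p%:Z - q%:Z) ^+ 2 - 2 * (p%:Z * q%:Z).

Lemma exponent_num_swap p q m n ab :
  exponent_num q p n m (ab.2, ab.1) = exponent_num p q m n ab.
Proof. by rewrite /exponent_num /=; ring. Qed.

Lemma exponent_num_intr (K : comNzRingType) p q m n ab :
  (exponent_num p q m n ab)%:~R =
  12 * (ab.2%:R * p%:R - ab.1%:R * q%:R) ^+ 2
  - (n%:R * p%:R - m%:R * q%:R) ^+ 2 + (p%:R - q%:R) ^+ 2
  - 2 * (p%:R * q%:R) :> K.
Proof.
by rewrite /exponent_num !expr2 !(intrD, intrB, intrM, rmorphN) /= -!pmulrn; ring.
Qed.

Lemma exponent_numE (R : realType) (p q m n : nat) (ab : nat * nat) :
  (0 < p)%N -> (0 < q)%N ->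
  conformal_weight R p q ab.1 ab.2 - central_charge R p q / 24
    - conformal_weight R p q m n / 12
  = (exponent_num p q m n ab)%:~R / (48 * (p * q))%N%:R.
Proof.
move=> p0 q0; rewrite exponent_num_intr !natrM /conformal_weight /central_charge.
by field; rewrite !pnatr_eq0 -!lt0n q0 p0.
Qed.

Lemma exponent_num_Fp (p q m n : nat) (ab : nat * nat) :
  prime p ->
  (exponent_num p q m n ab)%:~R =
  q%:R ^+ 2 * (12 * ab.1%:R ^+ 2 - m%:R ^+ 2 + 1) :> 'F_p.
Proof. by move=> p_pr; rewrite exponent_num_intr pchar_Fp_0 //; ring. Qed.

Lemma complete_admissible_list_swap (p q m n s : nat) (mn : 'I_s -> nat * nat) :
  complete_admissible_list p q m n mn ->
  complete_admissible_list q p n m (fun j => ((mn j).2, (mn j).1)).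
Proof.
have adm a b p' q' m' n' : admissible p' q' m' n' (a, b) -> admissible q' p' n' m' (b, a).
  by case=> /= h1 h2 /andP[h3 h3'] /andP[h4 h4'] /andP[h5 h5']; split=> //=; apply/andP.
case=> admP inj all; split=> [j|i j|[a b] /adm/all[j e]].
- by apply: adm; move: (admP j); case: (mn j).
- move=> e; apply: inj; move: e; rewrite /equivalent_pairs /=.
  by case: (mn i) (mn j) => a b [c d] /= [] [-> ->]; [left | right].
- exists j; move: e; rewrite /equivalent_pairs /=.
  by case: (mn j) => c d /= [] [-> ->]; [left | right].
Qed.

(** Solve y = x modulo p and y = 1 modulo the part of N prime to p: the residue modulo p
    is free even when a high power of p divides N. *)
Lemma coprime_congr_lift (p N x : nat) :
  prime p -> (0 < N)%N -> ~~ (p %| x)%N ->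
  exists y, coprime y N /\ y = x %[mod p].
Proof.
move=> p_pr N0 px.
have co : coprime p N`_p^' := pnat_coprime (pnat_id p_pr) (part_pnat _ _).
set y := chinese p N`_p^' x 1; have y_x : y = x %[mod p] := chinese_modl co x 1.
have y_1 : y = 1 %[mod N`_p^'] := chinese_modr co x 1.
clearbody y; exists y; split=> //; rewrite -(partnC p N0) coprimeMr; apply/andP; split.
  by rewrite p_part coprimeXr // coprime_sym prime_coprime // /dvdn y_x.
by rewrite -coprime_modl y_1 coprime_modl coprime1n.
Qed.

(** For every a in the allowed range some pair (a, b) is admissible, for instance with
    b = (n + 1)/2; the list contains it or its mirror (p - a, q - b), which has the
    same exponent modulo p. *)
Lemma square_stable_exponents (p q m n s N : nat) (mn : 'I_s -> nat * nat) :
  prime p -> (3 < p)%N -> ~~ (p %| q)%N -> odd m -> (m < p)%N -> odd n -> (n < q)%N ->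
  complete_admissible_list p q m n mn -> (0 < N)%N ->
  (forall x i, coprime x N -> exists j,
     (p%:Z %| exponent_num p q m n (mn j) - (x ^ 2)%N%:Z * exponent_num p q m n (mn i))%Z) ->
  m = 1%N \/ m = (p - 2)%N.
Proof.
move=> p_pr p3 pq m_odd m_lt_p n_odd n_lt_q [admP _ all] N0 stable.
have char_p := pchar_Fp p_pr.
have q0 : q%:R ^+ 2 != 0 :> 'F_p by rewrite expf_neq0 // -(dvdn_pcharf char_p).
apply: square_stable_values => // a x ma ap px.
have [i ei] : exists j, equivalent_pairs p q (mn j) (a, n./2.+1).
  by apply: all; split=> /=; lia.
have [y [coyN yx]] := coprime_congr_lift p_pr N0 px.
have [j] := stable y i coyN.
rewrite (dvdz_pcharf char_p) intrB intrM !exponent_num_Fp // subr_eq0.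
have -> : ((y ^ 2)%N%:Z)%:~R = x%:R ^+ 2 :> 'F_p.
  by rewrite -pmulrn natrX -(Fp_nat_mod p_pr y) yx Fp_nat_mod.
have -> : (mn i).1%:R ^+ 2 = a%:R ^+ 2 :> 'F_p.
  case: ei => [<- // | [-> _]].
  have [/andP[_ /andP[_ lt_p]] _ _ _ _] := admP i.
  by rewrite natrB ?(ltnW lt_p) // pchar_Fp_0 // sub0r sqrrN.
move=> /eqP e; exists (mn j).1.
case: (admP j) => _ _ /andP[? _] /andP[? _] _; split=> //.
by apply: (mulfI q0); rewrite e mulrCA.
Qed.

(** The transformation law at T expresses a multiple of S_i as a combination of the
    S_j; linear independence identifies the coefficients. *)
Lemma rho_translation (R : realType) (V : voa R[i]) (M : voa_module V)
    (s : nat) (W : 'I_s -> voa_module V) (I : forall j, M -> R[i] -> W j -> W j)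
    (h : 'I_s -> R) (c k : R) (u : M) (ups : 'M[int]_2 -> R[i])
    (rho : 'M[int]_2 -> 'M[R[i]]_s)
    (S := fun j => one_point (I j) (h j)%:C k%:C u) :
  Defs.charge V = c%:C -> lin_indep_on_H S -> eta_multiplier k ups ->
  transforms_by k ups S rho ->
  rho (translation 1) = diag_mx (\row_j e2pi (h j - c / 24 - k / 12)).
Proof.
move=> cV Sind upsP rhoS; apply/matrixP => i j; apply/eqP; rewrite -subr_eq0; apply/eqP.
move: j; apply: Sind => tau tauH.
have ST := SL2Z_translation 1.
have := rhoS _ tau ST tauH i.
have aut : automorphy (translation 1) tau = 1.
  by rewrite /automorphy !mxE /= mul0r add0r.
have moe : moebius (translation 1) tau = tau + 1.
  by rewrite /moebius aut !mxE /= mul1r divr1.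
rewrite /slash aut moe cpow1 mulr1 /S (one_point_translation _ _ _ _ _ cV) //.
rewrite (eta_multiplier_translation upsP ST) //; try by rewrite !mxE.
rewrite mulrA -e2piN -e2piD addrC => e.
under eq_bigr do rewrite mulrBl.
rewrite sumrB -e (bigD1 i) //= big1 => [|j ji]; last first.
  by rewrite !mxE eq_sym (negPf ji) mul0r.
by rewrite !mxE eqxx addr0 subrr.
Qed.

Theorem corollary1p1 (R : realType) (p q m n : nat)
  (hp : prime p) (hq : prime q) (hp3 : (3 < p)%N) (hq3 : (3 < q)%N)
  (hpq : p <> q)
  (hm : odd m) (hn : odd n)
  (hmp : (1 <= m <= p - 1)%N) (hnq : (1 <= n <= q - 1)%N)
  (hmn : (m, n) \notin
     [:: (1, 1); (1, q - 2); (p - 2, 1); (p - 2, q - 2)]%N)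
  (V : voa R[i]) (hV : is_minimal_model p q V)
  (M : voa_module V) (hM : is_L p q m n M)
  (s : nat) (mn : 'I_s -> nat * nat)
  (hmnj : complete_admissible_list p q m n mn)
  (W : 'I_s -> voa_module V)
  (hW : forall j, is_L p q (mn j).1 (mn j).2 (W j))
  (I : forall j, M -> R[i] -> W j -> W j)
  (hI : forall j, intertwining_operator (I j) /\ nonzero_modes (I j))
  (u : M)
  (hu : highest_weight_vector (conformal_weight R p q m n)%:C u)
  (S : 'I_s -> R[i] -> R[i])
  (hS : S = fun j => one_point (I j)
     (conformal_weight R p q (mn j).1 (mn j).2)%:C
     (conformal_weight R p q m n)%:C u)
  (hSind : lin_indep_on_H S)
  (ups : 'M[int]_2 -> R[i])
  (hups : eta_multiplier (conformal_weight R p q m n) ups)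
  (rho : 'M[int]_2 -> 'M[R[i]]_s)
  (hrho : is_representation rho)
  (hrhoS : transforms_by (conformal_weight R p q m n) ups S rho) :
  noncongruence rho.
Proof.
case=> N [N0 kerN]; subst S; case: hV => cV _ _.
have rhoT := rho_translation cV hSind hups hrhoS.
have pq0 : (0 < 48 * (p * q))%N by rewrite !muln_gt0 (prime_gt0 hp) (prime_gt0 hq).
have stable (x : nat) i : coprime x N -> exists j,
    ((48 * (p * q))%N%:Z %| exponent_num p q m n (mn j)
       - (x ^ 2)%N%:Z * exponent_num p q m n (mn i))%Z.
  move=> coxN; have [j] := congruence_spectrum hrho kerN coxN rhoT i.
  rewrite !mxE !exponent_numE ?prime_gt0 // -e2piMn mulrA => e; exists j.
  by apply: (@e2pi_ratio_eq_dvd R) => //; rewrite e intrM.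
have p_ndvd_q : ~~ (p %| q)%N by rewrite dvdn_prime2 //; exact/eqP.
have q_ndvd_p : ~~ (q %| p)%N by rewrite dvdn_prime2 // eq_sym; exact/eqP.
have mE : m = 1%N \/ m = (p - 2)%N.
  apply: (square_stable_exponents (q := q) (n := n) (N := N) (mn := mn)) => //; try lia.
  move=> x i /stable-/(_ i)[j d]; exists j; apply: dvdz_trans d.
  by rewrite dvdzE /= dvdn_mull // dvdn_mulr.
have nE : n = 1%N \/ n = (q - 2)%N.
  apply: (square_stable_exponents (q := p) (n := m) (N := N)
            (mn := fun j => ((mn j).2, (mn j).1))) => //; try lia.
    exact: complete_admissible_list_swap.
  move=> x i /stable-/(_ i)[j d]; exists j; rewrite !exponent_num_swap.
  by apply: dvdz_trans d; rewrite dvdzE /= dvdn_mull // dvdn_mull.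
by move: hmn; rewrite !inE !xpair_eqE; case: mE nE => -> [] ->; rewrite !eqxx ?orbT.
Qed.
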